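(* Let $G$ be a $d$-regular graph with $d\geq 5$, and let $F\subseteq\{0,1,2,\ldots,d\}$ with $|F|\leq 2$. Then $G$ admits an $F$-avoiding orientation, that is, an orientation $D$ of $G$ such that $d_D^+(v)\notin F$ for every $v\in V(G)$.
   Context: All graphs are finite and loopless; parallel edges are permitted, and degrees count edges with multiplicity. An orientation $D$ of $G$ assigns a direction to each edge of $G$, so that each edge points out of one of its endpoints and into the other. The out-degree $d_D^+(v)$ is the number of edges pointing out of $v$ in $D$. *)

(* Defs.v *)
From mathcomp Require Import all_boot.

Set Implicit Arguments.
Unset Strict Implicit.
Unset Printing Implicit Defensive.

(* Edges form a type of their own, so parallel edges are distinct elements of
   [edge G] with the same [ends]; the cardinality condition excludes loops. *)
Record multigraph := Multigraph {
  vertex : finType;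
  edge : finType;
  ends : edge -> {set vertex};
  card_ends : forall e, #|ends e| = 2
}.

Definition degree (G : multigraph) (v : vertex G) : nat :=
  #|[set e : edge G | v \in ends e]|.

Definition regular (d : nat) (G : multigraph) : Prop :=
  forall v : vertex G, degree v = d.

(* The edge [e] points out of [tail e] and into [head e]; these are distinct
   because [ends e] has two elements. *)
Record orientation (G : multigraph) := Orientation {
  tail : edge G -> vertex G;
  head : edge G -> vertex G;
  ends_tail_head : forall e, ends e = [set tail e; head e]
}.

Definition outdeg (G : multigraph) (D : orientation G) (v : vertex G) : nat :=
  #|[set e : edge G | tail D e == v]|.

(* A subset F of {0, ..., d} is a set over ['I_d.+1], whose elements are
   compared with out-degrees as natural numbers. *)
Definition avoiding (d : nat) (F : {set 'I_d.+1}) (G : multigraph)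
    (D : orientation G) : Prop :=
  forall (v : vertex G) (k : 'I_d.+1), k \in F -> outdeg D v <> k :> nat.

(* Main.v *)
Require Import Defs.
From mathcomp Require Import all_boot.
From mathcomp Require Import zify.
(* [seq] also exports a function [head]; here [head] is that of orientations. *)
Import Defs.

(** Let [F] have at most two elements, and call the elements of [F] other than
    [0] and [d] interior.

    - Cuts.  By Lovasz's decomposition argument, if [d <= p + q + 1] the vertex
      set splits into [A] and its complement so that every vertex of [A] has at
      most [p] neighbours (with multiplicity) in [A], and every other vertex at
      most [q] outside [A] ([exists_partition]).  Orient the cut from [A] to
      its complement and the remaining edges in a balanced way
      ([exists_cut_orientation]).

    - [F = {a, a + 1}], interior.  For suitable [p] and [q] that orientation
      has out-degrees at least [a + 2] in [A] and at most [a - 1] elsewhere;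
      [p] and [q] can be afforded exactly when [d >= 5] ([avoid_consecutive]).

    - [d >= 7], or at most one interior element.  Take [p = q = d./2] and start
      from the same orientation.  Now reversing cut edges only lowers the
      out-degrees in [A] and only raises the others, so a forbidden value, once
      left, never comes back.  Hence it is enough to give each vertex as many
      private cut edges as it has forbidden values within reach, and to reverse
      one of its private edges whenever it sits on a forbidden value
      ([greedy_flip], the idea of Frank, Lau and Szabo's proof for
      degree-constrained subgraphs).  The private edges come from a balanced
      orientation of the cut, whose degrees are at least [(d + 1)./2]
      ([avoid_few_interior]).

    - What is left is [d = 5] or [d = 6] and [F = {a, b}] interior with
      [a + 1 < b].  A balanced orientation of the whole graph succeeds, except
      for [F = {1, 3}] and its mirror image [{d - 3, d - 1}], which is reduced
      to [{1, 3}] by reversing all edges.  For [{1, 3}] one asks for even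
      out-degrees: in a component this is possible except for a parity
      obstruction, which disappears after giving out-degree 5 to a single
      vertex that does not disconnect its component ([avoid_1_3_component]). *)

Set Implicit Arguments.
Unset Strict Implicit.
Unset Printing Implicit Defensive.

(** * Degrees within a set of edges *)

Definition outdeg_in (G : multigraph) (D : orientation G) (X : {set edge G})
    (v : vertex G) : nat := \sum_(e in X) (tail D e == v).

Definition indeg_in (G : multigraph) (D : orientation G) (X : {set edge G})
    (v : vertex G) : nat := \sum_(e in X) (head D e == v).

Definition degree_in (G : multigraph) (X : {set edge G}) (v : vertex G) : nat :=
  \sum_(e in X) (v \in ends e).

Section Orientations.

Variable G : multigraph.
Implicit Types (D : orientation G) (X : {set edge G}) (v w x y : vertex G)
  (e : edge G) (A B S T : {set vertex G}).

Lemma mem_ends D e v : (v \in ends e) = (v == tail D e) || (v == head D e).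
Proof. by rewrite (ends_tail_head D) !inE. Qed.

Lemma tail_neq_head D e : tail D e != head D e.
Proof.
apply/eqP => E; have := card_ends e.
by rewrite (ends_tail_head D) E setUid cards1.
Qed.

Lemma eq_head D D' e : tail D e = tail D' e -> head D e = head D' e.
Proof.
move=> E; have := mem_ends D' e (head D e).
rewrite (mem_ends D) eqxx orbT -E eq_sym (negbTE (tail_neq_head D e)) /=.
by move/esym/eqP.
Qed.

Lemma exists_orientation : inhabited (orientation G).
Proof.
have P e : exists p : vertex G * vertex G, ends e == [set p.1; p.2].
  have /cards2P[x [y [_ ->]]] : #|ends e| == 2 by rewrite card_ends.
  by exists (x, y).
pose f e := xchoose (P e).
have fP e : ends e = [set (f e).1; (f e).2] by apply/eqP/(xchooseP (P e)).
exact: inhabits (Orientation fP).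
Qed.

Lemma flip_proof D X e :
  ends e = [set if e \in X then head D e else tail D e;
                if e \in X then tail D e else head D e].
Proof. by case: ifP; rewrite (ends_tail_head D) // setUC. Qed.

Definition flip D X : orientation G := Orientation (flip_proof D X).

Lemma outdegE D v : outdeg D v = outdeg_in D setT v.
Proof.
rewrite /outdeg /outdeg_in -sum1dep_card big_mkcond /=.
by apply: eq_big => [e|e _]; rewrite ?inE //; case: eqP.
Qed.

Lemma degreeE v : degree v = degree_in setT v :> nat.
Proof.
rewrite /degree /degree_in -sum1dep_card big_mkcond /=.
by apply: eq_big => [e|e _]; rewrite ?inE //; case: (v \in ends e).
Qed.

Lemma outdeg_indeg D X v : outdeg_in D X v + indeg_in D X v = degree_in X v.
Proof.
rewrite -big_split; apply: eq_bigr => e _ /=.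
rewrite (mem_ends D) ![v == _]eq_sym.
case: eqP => [<-|_] //=.
by rewrite eq_sym (negbTE (tail_neq_head D e)).
Qed.

Lemma outdegID D X v : outdeg D v = outdeg_in D X v + outdeg_in D (~: X) v.
Proof.
rewrite outdegE /outdeg_in (bigID (mem X)) /=.
by congr (_ + _); apply: eq_bigl => e; rewrite !inE.
Qed.

Lemma degreeID X v : degree v = degree_in X v + degree_in (~: X) v.
Proof.
rewrite degreeE /degree_in (bigID (mem X)) /=.
by congr (_ + _); apply: eq_bigl => e; rewrite !inE.
Qed.

Lemma eq_outdeg_in D D' X v :
  (forall e, e \in X -> v \in ends e -> tail D e = tail D' e) ->
  outdeg_in D X v = outdeg_in D' X v.
Proof.
move=> E; apply: eq_bigr => e eX; case ev: (v \in ends e); first by rewrite E.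
have tN D0 : (tail D0 e == v) = false.
  by apply: contraFF ev => /eqP<-; rewrite (mem_ends D0) eqxx.
by rewrite !tN.
Qed.

Lemma eq_indeg_in D D' X v :
  (forall e, e \in X -> v \in ends e -> tail D e = tail D' e) ->
  indeg_in D X v = indeg_in D' X v.
Proof.
move=> E; have := outdeg_indeg D X v.
by rewrite -(outdeg_indeg D' X v) (eq_outdeg_in E) => /addnI.
Qed.

Lemma outdeg_flip1 D X e v : e \in X ->
  outdeg_in (flip D [set e]) X v + (v == tail D e)
    = outdeg_in D X v + (v == head D e).
Proof.
move=> eX; rewrite /outdeg_in !(bigD1 e eX) /= set11 ![v == _]eq_sym.
rewrite addnAC [in RHS]addnAC (addnC (nat_of_bool (head D e == v))).
congr (_ + _); apply: eq_bigr => f /andP[_ /negbTE fe].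
by rewrite inE fe.
Qed.

Lemma sum_outdeg D X S :
  \sum_(v in S) outdeg_in D X v = \sum_(e in X) (tail D e \in S).
Proof.
rewrite exchange_big /=; apply: eq_bigr => e _.
have [tS|tS] := boolP (tail D e \in S).
  rewrite (bigD1 (tail D e)) //= eqxx big1 ?addn0 // => v.
  by rewrite eq_sym => /andP[_ /negbTE->].
by rewrite big1 // => v vS; case: eqP => // E; rewrite E vS in tS.
Qed.

Lemma sum_indeg D X S :
  \sum_(v in S) indeg_in D X v = \sum_(e in X) (head D e \in S).
Proof.
rewrite exchange_big /=; apply: eq_bigr => e _.
have [tS|tS] := boolP (head D e \in S).
  rewrite (bigD1 (head D e)) //= eqxx big1 ?addn0 // => v.
  by rewrite eq_sym => /andP[_ /negbTE->].
by rewrite big1 // => v vS; case: eqP => // E; rewrite E vS in tS.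
Qed.

(** * Balanced orientations *)

Definition arc D X : rel (vertex G) :=
  [rel x y | [exists e in X, (tail D e == x) && (head D e == y)]].

(** Reversing a simple directed path moves one unit of out-degree from its
    first vertex to its last.  The first conjunct serves the induction: the
    first edge of the path is not affected by the reversal of the rest. *)
Lemma reverse_path D X x p : path (arc D X) x p -> uniq (x :: p) ->
  exists D',
    (forall e, ~~ (ends e \subset [set z in x :: p]) -> tail D' e = tail D e) /\
    (forall v, outdeg_in D' X v + (v == x) = outdeg_in D X v + (v == last x p)).
Proof.
elim: p x => [|y p IHp] x /=; first by exists D.
move=> /andP[/exists_inP[e eX /andP[/eqP te /eqP he]] xp] /andP[xNp up].
have [D1 [D1E D1out]] := IHp y xp up.
have tD1 : tail D1 e = x.
  rewrite D1E //; apply: contra xNp => /subsetP/(_ x).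
  by rewrite (mem_ends D) te eqxx !inE; apply.
have hD1 : head D1 e = y by rewrite -he; apply: eq_head; rewrite tD1.
exists (flip D1 [set e]); split=> [f fN|v]; last first.
  have := outdeg_flip1 D1 v eX; have := D1out v; rewrite tD1 hD1; lia.
have Efe : f != e.
  apply: contraNneq fN => ->; apply/subsetP => z; rewrite (mem_ends D) te he.
  by rewrite !inE => /orP[->|->]; rewrite ?orbT.
rewrite /= inE (negbTE Efe) D1E //; apply: contra fN => /subsetP sub.
by apply/subsetP => z /sub; rewrite !inE => ->; rewrite orbT.
Qed.

(** The sum over all vertices of the distance between out- and in-degree. *)
Definition imbalance D X : nat :=
  \sum_v ((outdeg_in D X v - indeg_in D X v)
          + (indeg_in D X v - outdeg_in D X v)).

(** No arc leaves the set of vertices reachable from [v], so its total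
    out-degree is at most its total in-degree and some [u] in it has more in-
    than out-arcs.  Reversing a path from [v] to [u] lowers the imbalance at [v]
    by 2 and does not raise it at [u]. *)
Lemma reduce_imbalance D X v : (indeg_in D X v).+1 < outdeg_in D X v ->
  exists D', imbalance D' X < imbalance D X.
Proof.
move=> vbig; pose R := [set x | connect (arc D X) v x].
have vR : v \in R by rewrite inE connect0.
have [u uR ult] : exists2 u, u \in R & outdeg_in D X u < indeg_in D X u.
  apply/exists_inP; apply: contraLR vbig => /exists_inPn notin.
  have le1 : \sum_(x in R) outdeg_in D X x <= \sum_(x in R) indeg_in D X x.
    rewrite sum_outdeg sum_indeg; apply: leq_sum => e eX.
    case tR: (tail D e \in R) => //; suff -> : head D e \in R by [].
    move: tR; rewrite !inE => /connect_trans-> //; apply: connect1.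
    by apply/exists_inP; exists e; rewrite ?eqxx.
  have le2 : \sum_(x in R | x != v) indeg_in D X x
                <= \sum_(x in R | x != v) outdeg_in D X x.
    by apply: leq_sum => x /andP[/notin]; rewrite -leqNgt.
  by move: le1; rewrite (bigD1 v) // [X in _ <= X](bigD1 v) //=; lia.
have uv : u != v by apply: contraTneq ult => ->; lia.
move: uR; rewrite inE => /connectP[p0 p0P Eu].
case: (shortenP p0P) Eu => p pP up _ Eu.
have [D' [_ D'out]] := reverse_path pP up; exists D'.
have D'in x := outdeg_indeg D' X x; have Din x := outdeg_indeg D X x.
have D'v := D'out v; have D'u := D'out u.
rewrite -Eu in D'v D'u.
rewrite !eqxx ?(negbTE uv) [v == u]eq_sym (negbTE uv) in D'v D'u.
rewrite /imbalance !(bigD1 v (isT : predT v)) //=.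
rewrite !(bigD1 u uv) /=.
have -> : \sum_(i | (i != v) && (i != u))
     (outdeg_in D' X i - indeg_in D' X i + (indeg_in D' X i - outdeg_in D' X i))
   = \sum_(i | (i != v) && (i != u))
     (outdeg_in D X i - indeg_in D X i + (indeg_in D X i - outdeg_in D X i)).
  apply: eq_bigr => i /andP[/negbTE iv /negbTE iu].
  have := D'out i; rewrite -Eu iv iu !addn0 => Ei.
  have := D'in i; rewrite -Din Ei => /addnI->; by [].
have := D'in v; have := D'in u; rewrite -!Din; lia.
Qed.

Lemma outdeg_flipT D X v : outdeg_in (flip D setT) X v = indeg_in D X v.
Proof. by apply: eq_bigr => e _; rewrite /= inE. Qed.

Lemma indeg_flipT D X v : indeg_in (flip D setT) X v = outdeg_in D X v.
Proof. by apply: eq_bigr => e _; rewrite /= inE. Qed.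

Lemma exists_balanced X : exists D, forall v,
  outdeg_in D X v <= (indeg_in D X v).+1 /\
  indeg_in D X v <= (outdeg_in D X v).+1.
Proof.
have [D] := exists_orientation.
have [n] := ubnP (imbalance D X); elim: n D => // n IHn D leDn.
have step D' : imbalance D' X < imbalance D X ->
    exists D, forall v, outdeg_in D X v <= (indeg_in D X v).+1
      /\ indeg_in D X v <= (outdeg_in D X v).+1.
  by move=> lt'; apply: (IHn D'); apply: leq_trans lt' _.
have [bal|/forallPn[v]] := boolP [forall v,
  (outdeg_in D X v <= (indeg_in D X v).+1)
    && (indeg_in D X v <= (outdeg_in D X v).+1)].
  by exists D => v; apply/andP; move/forallP: bal.
rewrite negb_and -!ltnNge => /orP[lt_io|lt_oi].
  by have [D' /step] := reduce_imbalance lt_io.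
have [|D' lt'] := @reduce_imbalance (flip D setT) X v.
  by rewrite outdeg_flipT indeg_flipT.
apply: (step D'); apply: leq_trans lt' _; apply: leq_sum => w _.
by rewrite outdeg_flipT indeg_flipT addnC.
Qed.

(** * Cuts *)

Definition cut A : {set edge G} :=
  [set e | ~~ (ends e \subset A) && ~~ (ends e \subset ~: A)].

Lemma in_cut D A e : (e \in cut A) = ((tail D e \in A) != (head D e \in A)).
Proof.
rewrite inE (ends_tail_head D) !subUset !sub1set !inE.
by case: (_ \in A); case: (_ \in A).
Qed.

(** Toggling the membership of [v] exchanges the roles of cut and non-cut for
    the edges at [v] and leaves the other edges alone. *)
Lemma cut_toggle A B v : (forall w, (w \in B) = (w \in A) (+) (w == v)) ->
  forall e, (e \in ~: cut B) = (e \in ~: cut A) (+) (v \in ends e).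
Proof.
move=> AB e; have [D] := exists_orientation.
rewrite !in_setC !(in_cut D) !AB (mem_ends D) !(eq_sym v).
have := tail_neq_head D e; case: (tail D e =P v) => [->|_].
  by rewrite eq_sym => /negbTE->; do 2 case: (_ \in A).
by case: (head D e == v); do 2 case: (_ \in A).
Qed.

Lemma card_cut_toggle A B v :
    (forall w, (w \in B) = (w \in A) (+) (w == v)) ->
  #|~: cut B| + degree_in (~: cut A) v = #|~: cut A| + degree_in (cut A) v.
Proof.
move=> /cut_toggle AB; rewrite -!sum1_card ![\sum_(_ in _) 1]big_mkcond /=.
rewrite /degree_in ![\sum_(_ in _) (_ : bool)]big_mkcond -!big_split /=.
apply: eq_bigr => e _; rewrite AB in_setC.
by case: (_ \in cut A); case: (_ \in ends e).
Qed.

(** Minimize the number of non-cut edges plus [q] for each vertex in [A] and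
    [p] for each vertex outside.  Moving a vertex with too many non-cut edges
    to the other side would make this quantity strictly smaller. *)
Lemma exists_partition d p q : regular d G -> d <= (p + q).+1 ->
  exists A, forall v, degree_in (~: cut A) v <= if v \in A then p else q.
Proof.
move=> regG dpq.
pose phi A := #|~: cut A| + (q * #|A| + p * #|~: A|).
have [A _ Amin] := arg_minnP phi (isT : predT (set0 : {set vertex G})).
exists A => v; have := degreeID (cut A) v; rewrite regG => degv.
case: ifP => vA; rewrite leqNgt; apply/negP => big.
  have AB w : (w \in A :\ v) = (w \in A) (+) (w == v).
    by rewrite !inE; case: eqP => [->|_]; rewrite ?vA ?addbF.
  have := Amin (A :\ v) isT; have := card_cut_toggle AB.
  have := cardsD1 v A; have := cardsC A; have := cardsC (A :\ v).
  rewrite vA /phi; lia.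
have AB w : (w \in v |: A) = (w \in A) (+) (w == v).
  by rewrite !inE; case: eqP => [->|_]; rewrite ?vA ?addbF.
have := Amin (v |: A) isT; have := card_cut_toggle AB.
have := cardsU1 v A; have := cardsC A; have := cardsC (v |: A).
rewrite vA /phi; lia.
Qed.

Lemma exists_cut_orientation A : exists D,
  (forall e, e \in cut A -> tail D e \in A /\ head D e \notin A) /\
  forall v, outdeg_in D (~: cut A) v <= (indeg_in D (~: cut A) v).+1 /\
            indeg_in D (~: cut A) v <= (outdeg_in D (~: cut A) v).+1.
Proof.
have [D balD] := exists_balanced (~: cut A).
pose D' := flip D [set e in cut A | tail D e \notin A]; exists D'; split.
  move=> e ecut; rewrite /= in_set ecut /=; move: ecut; rewrite (in_cut D).
  by case: (boolP (tail D e \in A)) => tA /=; case: (_ \in A).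
have E v e : e \in ~: cut A -> v \in ends e -> tail D' e = tail D e.
  by rewrite in_setC /= in_set => /negbTE->.
by move=> v; rewrite (eq_outdeg_in (E v)) (eq_indeg_in (E v)).
Qed.

Lemma cut_orientation_degrees D A :
    (forall e, e \in cut A -> tail D e \in A /\ head D e \notin A) ->
  forall v, outdeg_in D (cut A) v = (if v \in A then degree_in (cut A) v else 0)
    /\ indeg_in D (cut A) v = (if v \in A then 0 else degree_in (cut A) v).
Proof.
move=> AD v; rewrite -(outdeg_indeg D); case: ifP => vA.
  suff -> : indeg_in D (cut A) v = 0 by rewrite addn0.
  by apply: big1 => e /AD[_]; case: eqP => // ->; rewrite vA.
suff -> : outdeg_in D (cut A) v = 0 by [].
by apply: big1 => e /AD[+ _]; case: eqP => // ->; rewrite vA.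
Qed.

(** The bounds [p] and [q] are the largest for which balance leaves in-degree
    at most [d - a - 2] in [A] and out-degree at most [a - 1] elsewhere; their
    sum [2 d - 6] reaches [d - 1] because [d >= 5]. *)
Lemma avoid_consecutive d a : regular d G -> 5 <= d -> 0 < a -> a.+2 <= d ->
  exists D, forall v, outdeg D v <> a /\ outdeg D v <> a.+1.
Proof.
move=> regG d5 a0 ad.
have [|A degA] := @exists_partition d (d - a.+2).*2 a.-1.*2 regG; first by lia.
have [D [AD balD]] := exists_cut_orientation A; exists D => v.
have := degA v; have := balD v; have := cut_orientation_degrees AD v.
have := degreeID (cut A) v; rewrite (outdegID D (cut A)) regG.
have := outdeg_indeg D (~: cut A) v; case: ifP => _; lia.
Qed.

(** * Greedy reversal along a cut *)

(** The forbidden values in the range of out-degrees that [v] can take when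
    only edges of [X] are reversed. *)
Definition reachable_forbidden d (F : {set 'I_d.+1}) D X v :=
  [set k in F | (outdeg D v <= k + outdeg_in D X v)
                && (k <= outdeg D v + indeg_in D X v)].

Lemma indeg_in_setD1 D X e v : e \in X ->
  indeg_in D X v = (head D e == v) + indeg_in D (X :\ e) v.
Proof. exact: big_setD1. Qed.

Lemma outdeg_in_setD1 D X e v : e \in X ->
  outdeg_in D X v = (tail D e == v) + outdeg_in D (X :\ e) v.
Proof. exact: big_setD1. Qed.

(** The edges of [X] go from sources to sinks, so the current out-degree of a
    vertex is an end of its range.  If it is forbidden at [v], reverse an edge
    whose head in [D'] is [v] and freeze it: the range of [v] loses that end,
    which pays for the edge, and no other range grows.  The orientation [D']
    only serves to allot the edges of [X] to the vertices. *)
Lemma greedy_flip d (F : {set 'I_d.+1}) D D' X :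
    {in X &, forall e f, tail D e != head D f} ->
    (forall v, #|reachable_forbidden F D X v| <= indeg_in D' X v) ->
  exists D'', avoiding F D''.
Proof.
have [n] := ubnP #|X|; elim: n X D => // n IHn X D ltXn sepX cap.
have [/forallP ok|/forallPn[v]] :=
    boolP [forall v, forall k in F, outdeg D v != k].
  by exists D => v k kF; apply/eqP; move/forall_inP: (ok v); apply.
move=> /forall_inPn[k kF]; rewrite negbK => /eqP outk.
have kreach : k \in reachable_forbidden F D X v.
  by rewrite inE kF outk !leq_addr.
have [e eX hev] : exists2 e, e \in X & head D' e == v.
  apply/exists_inP; apply: contraLR (cap v) => /exists_inPn none.
  rewrite -ltnNge /indeg_in big1 ?card_gt0 => [|f fX].
    by apply/set0Pn; exists k.
  by rewrite (negbTE (none f fX)).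
pose D1 := flip D [set e].
have tD1 f : f \in X :\ e -> tail D1 f = tail D f.
  by rewrite /= !inE => /andP[/negbTE->].
have hD1 f : f \in X :\ e -> head D1 f = head D f by move/tD1/eq_head.
have ltX : #|X :\ e| < n by move: ltXn; rewrite (cardsD1 e X) eX; lia.
apply: (IHn (X :\ e) D1) => // [f g fX gX|w].
  rewrite tD1 // hD1 //; apply: sepX; first by case/setD1P: fX.
  by case/setD1P: gX.
have Eout : outdeg_in D1 (X :\ e) w = outdeg_in D (X :\ e) w.
  by apply: eq_outdeg_in => f /tD1.
have Ein : indeg_in D1 (X :\ e) w = indeg_in D (X :\ e) w.
  by apply: eq_indeg_in => f /tD1.
have Eall : outdeg D1 w + (w == tail D e) = outdeg D w + (w == head D e).
  by rewrite !outdegE outdeg_flip1.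
have Xout := outdeg_in_setD1 D w eX; have Xin := indeg_in_setD1 D w eX.
have sub :
  reachable_forbidden F D1 (X :\ e) w \subset reachable_forbidden F D X w.
  apply/subsetP => j; rewrite !inE Eout Ein Xout Xin ![_ == w]eq_sym.
  move=> /and3P[-> *].
  by apply/andP; lia.
have := cap w; rewrite (indeg_in_setD1 D' w eX).
have [Ew|_] := eqVneq (head D' e) w; last first.
  exact: leq_trans (subset_leq_card sub).
have Evw : v = w by rewrite -Ew (eqP hev).
rewrite -Evw in Eout Ein Eall Xout Xin sub *.
move=> capv; rewrite -ltnS -add1n; apply: leq_trans capv; apply: proper_card.
rewrite properE sub /=; apply/subsetPn; exists k => //.
rewrite !inE kF /= Eout Ein -outk.
have : v \in ends e by rewrite (mem_ends D') (eqP hev) eqxx orbT.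
rewrite (mem_ends D) => /orP[vt|vh].
  (* A source: its out-degree drops below [k], the top of its range. *)
  have zin : indeg_in D X v = 0.
    by apply: big1 => f fX; apply/eqP; rewrite eqb0 (eqP vt) eq_sym sepX.
  have := tail_neq_head D e; rewrite -(eqP vt) => vh.
  move: Eall; rewrite vt (negbTE vh); lia.
(* A sink: its out-degree rises above [k], the bottom of its range. *)
have zout : outdeg_in D X v = 0.
  by apply: big1 => f fX; apply/eqP; rewrite eqb0 (eqP vh) sepX.
have := tail_neq_head D e; rewrite -(eqP vh) eq_sym => vt.
move: Eall; rewrite vh (negbTE vt); lia.
Qed.

(** A vertex with [h] cut edges is allotted [h./2] of them or more, and
    [h >= uphalf d >= 3].  The allotment is at least 2 unless [h = 3], which
    forces [d = 5] or [d = 6]; then balance gives the vertex both an in- and an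
    out-edge off the cut, so that neither [0] nor [d] is in its range. *)
Lemma avoid_few_interior d (F : {set 'I_d.+1}) : regular d G -> 5 <= d ->
    #|F| <= 2 -> 7 <= d \/ #|[set k in F | 0 < k < d]| <= 1 ->
  exists D, avoiding F D.
Proof.
move=> regG d5 F2 Fint.
have [|A degA] := @exists_partition d d./2 d./2 regG; first by lia.
have [D [AD balD]] := exists_cut_orientation A.
have [D' balD'] := exists_balanced (cut A).
apply: (@greedy_flip d F D D' (cut A)) => [e f /AD[te _] /AD[_ hf]|v].
  by apply: contraNneq hf => <-.
have := degA v; have := balD v; have := cut_orientation_degrees AD v.
have := degreeID (cut A) v; have := outdegID D (cut A) v; rewrite regG.
have := outdeg_indeg D (~: cut A) v; have := balD' v.
have := outdeg_indeg D' (cut A) v; rewrite if_same.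
move=> h1 h2 h3 h4 h5 h6 h7 h8.
have le2 : #|reachable_forbidden F D (cut A) v| <= 2.
  apply: leq_trans F2; apply: subset_leq_card; apply/subsetP => k.
  by rewrite inE => /andP[].
have [big|small] := leqP 4 (degree_in (cut A) v).
  by apply: leq_trans le2 _; lia.
case: Fint => [|Fint]; first by lia.
have le1 : #|reachable_forbidden F D (cut A) v| <= 1.
  apply: leq_trans Fint; apply: subset_leq_card; apply/subsetP => k.
  rewrite !inE => /andP[-> /=]; move: h6; case: ifP => _; lia.
by apply: leq_trans le1 _; lia.
Qed.

Lemma exists_middle_orientation d : regular d G ->
  exists D, forall v, d./2 <= outdeg D v <= uphalf d.
Proof.
move=> regG; have [D balD] := exists_balanced [set: edge G]; exists D => v.
have := balD v; have := outdeg_indeg D setT v.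
rewrite outdegE -degreeE regG; lia.
Qed.

(** * Parities of out-degrees *)

Definition adjacent_in S : rel (vertex G) :=
  [rel x y | [&& x != y, [exists e, ends e == [set x; y]]
               & [set x; y] \subset S]].

Lemma adjacent_in_sym S : symmetric (adjacent_in S).
Proof. by move=> x y; rewrite /adjacent_in /= eq_sym (setUC [set x]). Qed.

Lemma outdeg_flip1T D e v :
  outdeg (flip D [set e]) v + (v == tail D e) = outdeg D v + (v == head D e).
Proof. by rewrite !outdegE outdeg_flip1 ?in_setT. Qed.

Lemma addb_eq v x y : x != y -> (v == x) (+) (v == y) = (v \in [set x; y]).
Proof.
by move=> xy; rewrite !inE; case: eqP => // ->; rewrite (negbTE xy).
Qed.

(** Reversing the edges of a walk, in whatever directions they point, changes
    the parity at its two ends only: each inner visit changes it twice. *)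
Lemma toggle_parity D S x y : connect (adjacent_in S) x y ->
  exists D', (forall e, ~~ (ends e \subset S) -> tail D' e = tail D e) /\
    forall v, odd (outdeg D' v) = odd (outdeg D v) (+) (v == x) (+) (v == y).
Proof.
case/connectP => p; elim: p x => [|z p IHp] x /=.
  by move=> _ ->; exists D; split=> // v; rewrite addbK.
move=> /andP[/and3P[xz /existsP[e /eqP eE] sub] zp] Ey.
have [D1 [D1E D1odd]] := IHp z zp Ey.
exists (flip D1 [set e]); split=> [f fS|v].
  rewrite /= inE D1E //; case: eqP => // Ef.
  by rewrite Ef eE sub in fS.
have := congr1 odd (outdeg_flip1T D1 e v); rewrite !oddD !oddb D1odd.
have Exz : (v == x) (+) (v == z) = (v == tail D1 e) (+) (v == head D1 e).
  by rewrite !addb_eq ?tail_neq_head // -ends_tail_head eE.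
by move: Exz; case: (v == x); case: (v == z); case: (v == y);
  case: (v == tail _ _); case: (v == head _ _); case: (odd _); case: (odd _).
Qed.

(** A path to [r] from each offending vertex is reversed in turn; the parity
    at [r] absorbs the corrections. *)
Lemma even_outdegrees D S r :
    {in S, forall x, connect (adjacent_in S) x r} ->
  exists D', (forall e, ~~ (ends e \subset S) -> tail D' e = tail D e) /\
    {in S, forall v, v != r -> ~~ odd (outdeg D' v)}.
Proof.
move=> connS; have [n] := ubnP #|[set v in S | (v != r) && odd (outdeg D v)]|.
elim: n D => // n IHn D ltn.
have [/set0Pn[x]|] :=
    boolP ([set v in S | (v != r) && odd (outdeg D v)] != set0).
  rewrite inE => /and3P[xS xr xodd].
  have [D1 [D1E D1odd]] := toggle_parity D (connS x xS).
  have [|D2 [D2E D2odd]] := IHn D1; last first.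
    by exists D2; split=> // e eS; rewrite D2E // D1E.
  rewrite -ltnS; apply: leq_trans ltn; rewrite ltnS; apply: proper_card.
  rewrite properE; apply/andP; split.
    apply/subsetP => v; rewrite !inE D1odd => /and3P[-> vr].
    rewrite (negbTE vr) addbF; case: eqP => [->|_]; first by rewrite xodd.
    by rewrite addbF.
  apply/subsetPn; exists x; first by rewrite inE xS xr.
  by rewrite inE D1odd eqxx (negbTE xr) xodd /= !andbF.
rewrite negbK => /eqP E0; exists D; split=> // v vS vr; apply/negP => vodd.
by have := in_set0 v; rewrite -E0 inE vS vr vodd.
Qed.

Definition component r := [set x | connect (adjacent_in setT) r x].

Lemma adjacent_inS S T : S \subset T -> subrel (adjacent_in S) (adjacent_in T).
Proof.
move=> ST x y /and3P[xy xyE xyS]; apply/and3P; split=> //.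
exact: subset_trans ST.
Qed.

Lemma component_connect r x : x \in component r ->
  connect (adjacent_in (component r)) x r.
Proof.
rewrite inE => /connectP[p]; elim/last_ind: p x => [|p y IHp] x.
  by move=> _ ->.
rewrite rcons_path last_rcons => /andP[pP py] ->.
have lC : last r p \in component r by rewrite inE; apply/connectP; exists p.
apply: connect_trans (IHp _ pP erefl); apply: connect1.
rewrite adjacent_in_sym; have /and3P[ne neE _] := py; apply/and3P; split=> //.
rewrite subUset !sub1set lC inE; apply/connectP; exists (rcons p y).
  by rewrite rcons_path pP.
by rewrite last_rcons.
Qed.

(** Take a maximal proper subset [S] of the component that contains [r] and is
    connected.  An edge leaves [S]; adding its other end [w] keeps the subset
    connected, so by maximality [w] is all that was missing. *)
Lemma exists_noncut r : component r != [set r] ->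
  exists2 w, (w \in component r) && (w != r) &
    {in component r :\ w, forall x,
       connect (adjacent_in (component r :\ w)) x r}.
Proof.
set C := component r => Cr; have rC : r \in C by rewrite inE connect0.
pose P S := [&& r \in S, S \proper C &
  [forall x in S, connect (adjacent_in S) x r]].
have P1 : P [set r].
  rewrite /P inE eqxx properEneq eq_sym Cr sub1set rC /=.
  by apply/forall_inP => x /set1P->; apply: connect0.
have [S /maxsetP[PS maxS] _] := maxset_exists P1.
case/and3P: PS => rS SC /forall_inP connS.
have [a aS [w wS aw]] : exists2 a, a \in S &
    exists2 w, w \notin S & adjacent_in setT a w.
  suff /exists_inP[a aS /exists_inP[w wS aw]] :
    [exists a in S, [exists w in ~: S, adjacent_in setT a w]].
    by exists a => //; exists w; rewrite -1?in_setC.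
  apply: contraLR SC => closedS; rewrite properE negb_and negbK.
  apply/orP; right.
  have cl : closed (adjacent_in setT) S.
    apply: intro_closed => [|x y xy xS].
      exact/sym_connect_sym/adjacent_in_sym.
    apply: contraR closedS => yS; apply/exists_inP; exists x => //.
    by apply/exists_inP; exists y; rewrite ?in_setC.
  by apply/subsetP => x; rewrite inE => /(closed_connect cl) <-.
have SCs := proper_sub SC.
have wC : w \in C.
  have := subsetP SCs a aS; rewrite !inE => /connect_trans; apply.
  exact: connect1.
have wr : w != r by apply: contraNneq wS => ->.
have connW : {in w |: S, forall x, connect (adjacent_in (w |: S)) x r}.
  have sub : subrel (connect (adjacent_in S)) (connect (adjacent_in (w |: S))).
    apply: connect_sub => x y xy; apply: connect1; apply: adjacent_inS xy.
    exact: subsetUr.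
  move=> x /setU1P[->|xS]; last by apply: sub; apply: connS.
  apply: connect_trans (sub _ _ (connS _ aS)); apply: connect1.
  rewrite adjacent_in_sym; case/and3P: aw => aw awE _; apply/and3P; split=> //.
  by rewrite subUset !sub1set !inE aS eqxx orbT.
have EC : w |: S = C.
  apply/eqP; rewrite eqEproper subUset sub1set wC SCs /=; apply/negP => pr.
  have := maxS (w |: S); rewrite /P in_setU1 rS orbT pr /=.
  have -> : [forall x in w |: S, connect (adjacent_in (w |: S)) x r].
    exact/forall_inP.
  move=> /(_ isT (subsetUr _ _)) E.
  by move: wS; rewrite -E setU11.
exists w; first by rewrite wC wr.
by rewrite -EC setU1K.
Qed.

Lemma exists_outdeg D v n : n <= degree v ->
  exists2 D', (forall e, v \notin ends e -> tail D' e = tail D e)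
            & outdeg D' v = n.
Proof.
move=> /card_geqP[s [us sn sub]].
pose X := [set e | (v \in ends e) && ((tail D e == v) != (e \in s))].
exists (flip D X) => [e ve|]; first by rewrite /= inE (negbTE ve).
rewrite -sn -(card_uniqP us); apply: eq_card => e; rewrite inE.
have := sub e; rewrite inE /= in_set (mem_ends D) !(eq_sym v).
have := tail_neq_head D e; have [->|tv] := eqVneq (tail D e) v.
  by move=> h _; case: (e \in s); rewrite /= ?eqxx // eq_sym (negbTE h).
have [hv _ _|hv _] := eqVneq (head D e) v.
  by case: (e \in s); rewrite /= ?(negbTE tv) // hv eqxx.
by case: (e \in s) => /= [/(_ isT)//|_]; rewrite (negbTE tv).
Qed.

Lemma eq_outdeg D D' v :
  (forall e, v \in ends e -> tail D e = tail D' e) -> outdeg D v = outdeg D' v.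
Proof. by move=> E; rewrite !outdegE; apply: eq_outdeg_in => e _; apply: E. Qed.

Lemma component_closed r e v : v \in ends e -> v \in component r ->
  ends e \subset component r.
Proof.
move=> ve vC; apply/subsetP => w we.
have [->//|vw] := eqVneq w v.
have := vC; rewrite !inE => /connect_trans; apply; apply: connect1.
apply/and3P; split; rewrite ?subsetT // 1?eq_sym //.
apply/existsP; exists e; rewrite eq_sym eqEcard card_ends cards2 eq_sym vw.
by rewrite subUset !sub1set ve we.
Qed.

Lemma sum_outdeg_component D D' r :
  \sum_(v in component r) outdeg D v = \sum_(v in component r) outdeg D' v.
Proof.
have E D0 : \sum_(v in component r) outdeg D0 v =
            \sum_e (ends e \subset component r).
  transitivity (\sum_(v in component r) outdeg_in D0 setT v).
    by apply: eq_bigr => v _; rewrite outdegE.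
  rewrite sum_outdeg big_mkcond; apply: eq_bigr => e _; rewrite inE.
  have te : tail D0 e \in ends e by rewrite (mem_ends D0) eqxx.
  congr nat_of_bool; apply/idP/idP => [|/subsetP/(_ _ te)//].
  exact: component_closed.
by rewrite !E.
Qed.

Lemma odd_sum_even (P : pred (vertex G)) (f : vertex G -> nat) :
  (forall v, P v -> ~~ odd (f v)) -> odd (\sum_(v | P v) f v) = false.
Proof.
move=> evf; rewrite (big_morph odd oddD (erefl : odd 0 = false)).
by rewrite big1 // => v /evf/negbTE.
Qed.

(** Make all out-degrees in the component even except perhaps at [r].  If the
    one at [r] is odd, then the component has an odd number of edges.  In that
    case give out-degree 5 to a non-cut vertex [w] and repeat the correction on
    the rest: the total being odd, the out-degree of [r] is now even. *)
Lemma avoid_1_3_component D r : (forall v, 5 <= degree v) ->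
  exists D',
    (forall e, ~~ (ends e \subset component r) -> tail D' e = tail D e) /\
    {in component r, forall v, outdeg D' v != 1 /\ outdeg D' v != 3}.
Proof.
move=> deg5; set C := component r.
have evenN n : ~~ odd n -> n != 1 /\ n != 3 by case: n => [|[|[|[]]]].
have rC : r \in C by rewrite inE connect0.
have [D1 [D1E D1even]] := even_outdegrees D (@component_connect r).
have [rodd|reven] := boolP (odd (outdeg D1 r)); last first.
  exists D1; split=> // v vC; apply: evenN.
  by have [->//|vr] := eqVneq v r; apply: D1even.
have [|w /andP[wC wr] connw] := @exists_noncut r.
  have [e re] : exists e, r \in ends e.
    have := leq_trans (isT : 0 < 5) (deg5 r); rewrite card_gt0.
    by case/set0Pn => e; rewrite inE => re; exists e.
  have := component_closed re rC; apply: contraTneq => ->.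
  by apply/negP => /subset_leq_card; rewrite card_ends cards1.
have [D2 D2E D2w] := exists_outdeg D1 (deg5 w).
have [D3 [D3E D3even]] := even_outdegrees D2 connw.
have sumE := sum_outdeg_component D1 D3 r.
have wN e : w \in ends e -> ~~ (ends e \subset C :\ w).
  by move=> we; apply/negP => /subsetP/(_ _ we); rewrite !inE eqxx.
have D3w : outdeg D3 w = 5.
  by rewrite -D2w; apply: eq_outdeg => e /wN/D3E.
have even_rest v : [&& v \in C, v != r & v != w] -> ~~ odd (outdeg D3 v).
  by case/and3P => vC vr vw; apply: D3even => //; apply/setD1P.
have D3r : ~~ odd (outdeg D3 r).
  move: rodd; have := congr1 odd sumE; rewrite !(bigD1 (P := mem C) r rC) /=.
  rewrite !oddD odd_sum_even => [|v /andP[vC vr]]; last exact: D1even.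
  rewrite addbF => ->; rewrite (bigD1 w) /=; last by rewrite wr andbT.
  rewrite oddD D3w odd_sum_even ?addbF; first by case: (odd _).
  by move=> v /andP[/andP[vC vr] vw]; apply: even_rest; apply/and3P.
exists D3; split=> [e eC|v vC].
  have eCw : ~~ (ends e \subset C :\ w).
    by apply: contra eC => /subset_trans; apply; apply: subD1set.
  rewrite D3E // D2E ?D1E //; apply: contra eC => we.
  exact: component_closed we wC.
have [->|vw] := eqVneq v w; first by rewrite D3w.
apply: evenN; have [->//|vr] := eqVneq v r.
by apply: even_rest; apply/and3P.
Qed.

Lemma avoid_1_3 : (forall v, 5 <= degree v) ->
  exists D, forall v, outdeg D v != 1 /\ outdeg D v != 3.
Proof.
move=> deg5; have [D] := exists_orientation.
pose bad D0 := [set v | (outdeg D0 v == 1) || (outdeg D0 v == 3)].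
have [n] := ubnP #|bad D|; elim: n D => // n IHn D ltn.
have [E0|/set0Pn[r rbad]] := eqVneq (bad D) set0.
  by exists D => v; apply/norP; have := in_set0 v; rewrite -E0 inE => ->.
have [D' [D'E D'ok]] := avoid_1_3_component D r deg5.
apply: (IHn D'); rewrite -ltnS; apply: leq_trans ltn; rewrite ltnS.
have notC v : v \in bad D' -> v \notin component r.
  by apply: contraL => /D'ok/andP; rewrite inE -negb_or.
apply: proper_card; rewrite properE; apply/andP; split.
  apply/subsetP => v vbad; move: (vbad) (notC v vbad); rewrite !inE => + vC.
  rewrite (eq_outdeg (D' := D)) // => e ve; apply: D'E.
  by apply/negP => /subsetP/(_ _ ve); rewrite inE; apply/negP.
apply/subsetPn; exists r => //; apply/negP => /notC.
by rewrite inE connect0.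
Qed.

Lemma outdeg_reverse D v : outdeg (flip D setT) v + outdeg D v = degree v.
Proof. by rewrite !outdegE outdeg_flipT addnC outdeg_indeg degreeE. Qed.

End Orientations.

(** * Combining the cases *)

Theorem theorem2 (d : nat) (G : multigraph) (F : {set 'I_d.+1}) :
  5 <= d -> regular d G -> #|F| <= 2 ->
  exists D : orientation G, avoiding F D.
Proof.
move=> d5 regG F2.
have [few|many] := leqP #|[set k in F | 0 < k < d]| 1.
  by apply: (avoid_few_interior regG d5 F2); right.
have [d7|d6] := leqP 7 d.
  by apply: (avoid_few_interior regG d5 F2); left.
have interior k : k \in F -> 0 < k < d.
  suff <- : [set k in F | 0 < k < d] = F by rewrite inE => /andP[].
  apply/eqP; rewrite eqEcard (leq_trans F2 many) andbT.
  by apply/subsetP => j; rewrite inE => /andP[].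
have [a [b [altb aF bF Fab]]] : exists a b : 'I_d.+1,
    [/\ a < b, a \in F, b \in F & forall k, k \in F -> k = a \/ k = b].
  have /cards2P[x [y [xy ->]]] : #|F| == 2.
    rewrite eqn_leq F2; apply: leq_trans many _; apply: subset_leq_card.
    by apply/subsetP => j; rewrite inE => /andP[].
  have memP k : k \in [set x; y] -> k = x \/ k = y.
    by case/set2P; [left|right].
  have := xy; rewrite -val_eqE /= neq_ltn => /orP[lt|lt].
    by exists x, y; split; rewrite ?inE ?eqxx ?orbT.
  exists y, x; split; rewrite ?inE ?eqxx ?orbT // => k /memP[]; by [right|left].
suff [D DP] : exists D : orientation G,
    forall v, outdeg D v <> a /\ outdeg D v <> b.
  by exists D => v k /Fab[->|->]; case: (DP v).
have := interior a aF; have := interior b bF => intb inta.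
have [Eb|gap] := eqVneq (b : nat) a.+1.
  by rewrite Eb; apply: (avoid_consecutive regG d5); lia.
have deg5 (v : vertex G) : 5 <= degree v by rewrite regG.
(* If [F] meets the middle, the gap leaves only [{1, 3}] and [{d - 3, d - 1}]. *)
have [mid|] :=
    boolP ((d./2 <= a <= uphalf d) || (d./2 <= b <= uphalf d)); last first.
  move=> mid; have [D DP] := exists_middle_orientation regG.
  by exists D => v; have := DP v; lia.
have [/andP[/eqP Ea /eqP Eb]|not13] :=
    boolP ((a == 1 :> nat) && (b == 3 :> nat)).
  have [D DP] := avoid_1_3 deg5; rewrite Ea Eb.
  by exists D => v; have [/eqP ? /eqP] := DP v.
(* Only [a = d - 3] and [b = d - 1] remain. *)
have [D DP] := avoid_1_3 deg5; exists (flip D setT) => v.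
have := DP v; have := outdeg_reverse D v; rewrite regG; lia.
Qed.
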